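(* Let $(r_i)_{i\ge1}$ be a Rademacher sequence. For any $n$ and any real numbers $(a_{ij})_{1\le i<j\le n}$ it holds that \[\mathbb{P}\Big(\sum_{1\le i<j\le n} r_i r_j a_{ij}\ge 0\Big)\ \ge\ \frac{2\sqrt3-3}{15}\ >\ \frac{3}{100}.\] If not all $a_{ij}$ ($1\le i<j\le n$) are zero, then \[\mathbb{P}\Big(\sum_{1\le i<j\le n} r_i r_j a_{ij}> 0\Big)\ \ge\ \frac{2\sqrt3-3}{15}\ >\ \frac{3}{100}.\]
   Context: A Rademacher sequence is a sequence of independent random variables $(r_i)_{i\ge1}$ with $\mathbb{P}(r_i=1)=\mathbb{P}(r_i=-1)=\tfrac12$. *)

(* Defs.v *)
From HB Require Import structures.
From mathcomp Require Import all_boot all_order all_algebra.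
From mathcomp Require Import all_classical all_reals all_analysis.

Set Implicit Arguments.
Unset Strict Implicit.
Unset Printing Implicit Defensive.

Import Order.TTheory GRing.Theory Num.Theory.
Import numFieldNormedType.Exports.

Local Open Scope classical_set_scope.
Local Open Scope ring_scope.

(* Mutual independence: the product rule over every finite subfamily. *)
Definition mutually_independent (d : measure_display) (T : measurableType d)
    (R : realType) (P : probability T R) (I : choiceType)
    (X : I -> {RV P >-> R}) : Prop :=
  forall (s : seq I) (B : I -> set R),
    uniq s -> (forall i, measurable (B i)) ->
    P (\bigcap_(i in [set` s]) (X i @^-1` B i)) =
      (\prod_(i <- s) P (X i @^-1` B i))%E.

(* The sequence is indexed from 0, so [r i] stands for r_{i+1}. *)
Definition rademacher_sequence (d : measure_display) (T : measurableType d)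
    (R : realType) (P : probability T R) (r : nat -> {RV P >-> R}) : Prop :=
  [/\ mutually_independent r,
      forall i, P [set w | r i w = 1] = (2^-1)%:E
    & forall i, P [set w | r i w = -1] = (2^-1)%:E].

(* Only the entries [a i j] with i < j are used. *)
Definition rademacher_chaos2 (d : measure_display) (T : measurableType d)
    (R : realType) (P : probability T R) (r : nat -> {RV P >-> R})
    (n : nat) (a : 'I_n -> 'I_n -> R) (w : T) : R :=
  \sum_(i < n) \sum_(j < n | (i < j)%N) r i w * r j w * a i j.

(* Main.v *)
Require Import Defs.
From HB Require Import structures.
From mathcomp Require Import all_boot all_order all_algebra.
From mathcomp Require Import all_classical all_reals all_analysis.
From mathcomp Require Import measurable_realfun ring lra.

Set Implicit Arguments.
Unset Strict Implicit.
Unset Printing Implicit Defensive.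

Import Order.TTheory GRing.Theory Num.Theory.
Import numFieldNormedType.Exports.

Local Open Scope classical_set_scope.
Local Open Scope ring_scope.

(** Write X for the chaos.  It has mean zero, and the theorem follows from two
moment facts.

- A centred variable with E X^4 <= kappa (E X^2)^2 and E X^2 > 0 satisfies
  P(X > 0) >= (2 sqrt 3 - 3) / kappa ([fourth_moment_mean_gt0]).  Indeed the
  quartic q(y) = 2 y + 3 y^2 - y^4 = y (2 - y) (y + 1)^2 is nonpositive for
  y <= 0 and at most 9 / (4 (2 sqrt 3 - 3)) everywhere, so that a multiple of
  q(X / v) lies below the indicator of X > 0; the linear term has mean zero, and
  v^2 = 2 kappa E X^2 / 3 is the best scale.

- A homogeneous chaos of order two satisfies E X^4 <= 15 (E X^2)^2
  ([mean_quad4]); 15 is the value of E X^4 / (E X^2)^2 for X = g^2 - 1 with g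
  standard Gaussian.  The chaos in the first k + 1 signs is Y + e L, where e is
  the last sign, Y the chaos in the first k signs and L a linear form in them.
  Odd powers of e have mean zero, hence
      E (Y + e L)^4 = E Y^4 + 6 E Y^2 L^2 + E L^4
  while E (Y + e L)^2 = E Y^2 + E L^2.  The induction closes because
      E L^4 <= 3 (E L^2)^2  and  E Y^2 L^2 <= 5 E Y^2 E L^2,
  as 6 * 5 = 2 * 15.  The constant 5 is again the Gaussian one; the bound
  sqrt (15 * 3) given by the Cauchy-Schwarz inequality would be too large.  Both
  estimates ([mean_lin_mul], [mean_quad_lin]) are proved by the same induction
  on the number of signs.

All this takes place on the finite cube of sign patterns with its uniform mean.
By independence every pattern of the first n signs has probability 2^-n, and
distinct patterns are disjoint events, so that a lower bound for a uniform mean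
of an indicator is one for the probability of the event
([probability_ge_mean]).  If all coefficients vanish, the chaos is zero and
P(X >= 0) = 1. *)

(** * The uniform mean over a finite type *)

Section UniformMean.
Context (R : realType) (T : finType).
Implicit Types (f g h : T -> R) (c : R).

Definition mean f : R := (\sum_s f s) / #|T|%:R.

Lemma eq_mean f g : f =1 g -> mean f = mean g.
Proof. by move=> fg; rewrite /mean (eq_bigr _ (fun s _ => fg s)). Qed.

Lemma meanD f g : mean (fun s => f s + g s) = mean f + mean g.
Proof. by rewrite /mean big_split mulrDl. Qed.

Lemma meanZ c f : mean (fun s => c * f s) = c * mean f.
Proof. by rewrite /mean -mulr_sumr mulrA. Qed.

Lemma mean_cst c : (0 < #|T|)%N -> mean (fun=> c) = c.
Proof.
by move=> T0; rewrite /mean sumr_const -[c *+ _]mulr_natr mulfK// pnatr_eq0 -lt0n.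
Qed.

Lemma mean0 : mean (fun=> 0) = 0.
Proof. by rewrite /mean big1 ?mul0r. Qed.

Lemma mean_ge0 f : (forall s, 0 <= f s) -> 0 <= mean f.
Proof. by move=> f0; rewrite divr_ge0 ?ler0n ?sumr_ge0. Qed.

Lemma le_mean f g : (forall s, f s <= g s) -> mean f <= mean g.
Proof. by move=> fg; rewrite ler_wpM2r ?invr_ge0 ?ler0n ?ler_sum. Qed.

(** The quadratic form behind the Cauchy-Schwarz inequality: it is the mean of
[(b * f s + c * g s) ^+ 2], expanded. *)
Lemma mean_sqr_comb (b c : R) f g :
  0 <= b ^+ 2 * mean (fun s => f s ^+ 2)
     + 2 * b * c * mean (fun s => f s * g s) + c ^+ 2 * mean (fun s => g s ^+ 2).
Proof.
rewrite -!meanZ -!meanD; apply: mean_ge0 => s.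
by have := sqr_ge0 (b * f s + c * g s); lra.
Qed.

Lemma mean_sqr_ge0 f : 0 <= mean (fun s => f s ^+ 2).
Proof. by apply: mean_ge0 => s; exact: sqr_ge0. Qed.

Lemma mean_CauchySchwarz f g :
  mean (fun s => f s * g s) ^+ 2
    <= mean (fun s => f s ^+ 2) * mean (fun s => g s ^+ 2).
Proof.
have H b c := mean_sqr_comb b c f g.
have A0 : 0 <= mean (fun s => f s ^+ 2) by apply: mean_ge0 => s; exact: sqr_ge0.
set A := mean (fun s => f s ^+ 2) in H A0 *.
set B := mean (fun s => g s ^+ 2) in H *; set C := mean _ in H *.
have [A00|A00] := eqVneq A 0.
  (* With A = 0 the form [2 b c C + c^2 B] is nonnegative only if C = 0. *)
  have H1 := H (- (B + 1)) C; have := H (- (B + 1) / 2) C; rewrite A00.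
  have := H 0 1; rewrite A00; have := sqr_ge0 C; nra.
have Ap : 0 < A by rewrite lt_def A00.
rewrite -(ler_pM2l Ap); have := H (- C) A; lra.
Qed.

End UniformMean.

(** * Moments of linear and quadratic forms in signs *)

Section Cube.
Context (R : realType) (n : nat).
Local Notation cube := {ffun 'I_n -> bool}.
Implicit Types (s : cube) (k : 'I_n) (f g h : cube -> R) (l u : 'I_n -> R).
Implicit Types (a : 'I_n -> 'I_n -> R) (m : nat).

(** The pattern [s] codes a point of {-1, 1}^n, [true] standing for -1. *)
Definition sgn s k : R := (-1) ^+ s k.
Definition flip k s : cube := [ffun i => s i (+) (i == k)].
Definition flip_invariant k f := forall s, f (flip k s) = f s.

Lemma flipK k : involutive (flip k).
Proof. by move=> s; apply/ffunP => i; rewrite !ffunE -addbA addbb addbF. Qed.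

Lemma sgn_flip k s : sgn (flip k s) k = - sgn s k.
Proof. by rewrite /sgn ffunE eqxx; case: (s k); rewrite /= ?opprK. Qed.

Lemma flip_invariant_sgn k i : i != k -> flip_invariant k (sgn^~ i).
Proof. by move=> ik s; rewrite /sgn ffunE (negbTE ik) addbF. Qed.

Lemma card_cube : #|{: cube}| = (2 ^ n)%N.
Proof. by rewrite card_ffun card_bool card_ord. Qed.

Lemma mean_const c : mean (fun _ : cube => c : R) = c.
Proof. by rewrite mean_cst // card_cube expn_gt0. Qed.

(** Flipping the sign [k] preserves the uniform mean and negates the function. *)
Lemma mean_odd k h : flip_invariant k h -> mean (fun s => sgn s k * h s) = 0.
Proof.
move=> hk; set e := mean _; suff: e = - e by lra.
rewrite {1}/e /mean (reindex_inj (inv_inj (flipK k))) -mulNr -sumrN.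
by congr (_ / _); apply: eq_bigr => s _; rewrite sgn_flip hk mulNr.
Qed.

(** This is how every moment is computed below: the part of [f] of odd degree in
the sign [k] does not contribute to the mean. *)
Lemma mean_split k f g h : flip_invariant k h ->
  (forall s, f s = g s + sgn s k * h s) -> mean f = mean g.
Proof. by move=> hk fE; rewrite (eq_mean fE) meanD (mean_odd hk) addr0. Qed.

(** The forms are truncated to the signs of index below [m], so that the
inductions run over [m] on one fixed cube. *)
Definition lin l m s : R := \sum_(i < n | (i < m)%N) l i * sgn s i.
Definition quad a m s : R :=
  \sum_(j < n | (j < m)%N) sgn s j * lin (a^~ j) j s.

Lemma sum_ltS (F : 'I_n -> R) k :
  \sum_(i < n | (i < k.+1)%N) F i = \sum_(i < n | (i < k)%N) F i + F k.
Proof.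
rewrite (bigD1 k) //= addrC; congr (_ + _); apply: eq_bigl => i.
by rewrite ltnS ltn_neqAle andbC.
Qed.

Lemma sum_lt0 (F : 'I_n -> R) : \sum_(i < n | (i < 0)%N) F i = 0.
Proof. by rewrite big1. Qed.

Lemma lin0 l s : lin l 0 s = 0. Proof. exact: sum_lt0. Qed.
Lemma quad0 a s : quad a 0 s = 0. Proof. exact: sum_lt0. Qed.

Lemma linS l k s : lin l k.+1 s = lin l k s + sgn s k * l k.
Proof. by rewrite /lin sum_ltS [sgn s k * _]mulrC. Qed.

Lemma quadS a k s : quad a k.+1 s = quad a k s + sgn s k * lin (a^~ k) k s.
Proof. exact: sum_ltS. Qed.

Lemma flip_invariant_lin l m k : (m <= k)%N -> flip_invariant k (lin l m).
Proof.
move=> mk s; apply: eq_bigr => i im; rewrite flip_invariant_sgn //.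
by apply: contraTneq im => ->; rewrite -leqNgt.
Qed.

Lemma flip_invariant_quad a m k : (m <= k)%N -> flip_invariant k (quad a m).
Proof.
move=> mk s; apply: eq_bigr => j jm; have jk := leq_trans jm mk.
rewrite (flip_invariant_lin _ (ltnW jk)) flip_invariant_sgn //.
by apply: contraTneq jk => ->; rewrite ltnn.
Qed.

Lemma segment_ind (Q : nat -> Prop) :
  Q 0%N -> (forall k : 'I_n, Q k -> Q k.+1) ->
  forall m, (m <= n)%N -> Q m.
Proof.
move=> Q0 QS; elim=> // m IH mn.
exact: (QS (Ordinal mn) (IH (ltnW mn))).
Qed.

Lemma sgn_sqr s k : sgn s k ^+ 2 = 1. Proof. exact: sqrr_sign. Qed.

Lemma mean_lin2 l m : (m <= n)%N ->
  mean (fun s => lin l m s ^+ 2) = \sum_(i < n | (i < m)%N) l i ^+ 2.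
Proof.
move: m; apply: segment_ind => [|k IH].
  by rewrite sum_lt0 -[RHS](mean0 R cube); apply: eq_mean => s;
    rewrite lin0 expr0n.
rewrite sum_ltS -IH -(mean_const (l k ^+ 2)) -meanD.
apply: (@mean_split k _ _ (fun s => 2 * lin l k s * l k)) => [s|s].
  by rewrite flip_invariant_lin.
by rewrite linS; have := sgn_sqr s k; set e := sgn s k => e2; ring: e2.
Qed.

Lemma mean_quad2 a m : (m <= n)%N ->
  mean (fun s => quad a m s ^+ 2) =
  \sum_(j < n | (j < m)%N) mean (fun s => lin (a^~ j) j s ^+ 2).
Proof.
move: m; apply: segment_ind => [|k IH].
  by rewrite sum_lt0 -[RHS](mean0 R cube); apply: eq_mean => s;
    rewrite quad0 expr0n.
rewrite sum_ltS -IH -meanD.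
apply: (@mean_split k _ _ (fun s => 2 * quad a k s * lin (a^~ k) k s)) => [s|s].
  by rewrite flip_invariant_lin // flip_invariant_quad.
by rewrite quadS; have := sgn_sqr s k; set e := sgn s k => e2; ring: e2.
Qed.

Lemma mean_quad a m : (m <= n)%N -> mean (quad a m) = 0.
Proof.
move: m; apply: segment_ind => [|k IH].
  by rewrite -[RHS](mean0 R cube); apply: eq_mean => s; rewrite quad0.
rewrite -[RHS]IH; apply: (@mean_split k _ _ (lin (a^~ k) k));
  first exact: flip_invariant_lin.
exact: quadS.
Qed.

(** For centred jointly Gaussian variables this is an equality, Wick's formula.  On the
cube, adding the sign e with coefficients b and c to L and M increases the right
side by everything that is added to the left one, and by 2 b^2 c^2 more. *)
Lemma mean_lin_mul l u m : (m <= n)%N ->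
  mean (fun s => lin l m s ^+ 2 * lin u m s ^+ 2) <=
  mean (fun s => lin l m s ^+ 2) * mean (fun s => lin u m s ^+ 2)
  + 2 * mean (fun s => lin l m s * lin u m s) ^+ 2.
Proof.
move: m; apply: segment_ind => [|k IH].
  rewrite (@eq_mean _ _ _ (fun=> 0)) => [|s];
    last by rewrite !lin0 expr0n mulr0.
  rewrite mean0; apply: addr_ge0; apply: mulr_ge0; rewrite ?ler0n ?sqr_ge0 //;
    exact: mean_sqr_ge0.
set L := lin l k in IH *; set M := lin u k in IH *; set b := l k; set c := u k.
have Lk : flip_invariant k L by exact: flip_invariant_lin.
have Mk : flip_invariant k M by exact: flip_invariant_lin.
have -> : mean (fun s => lin l k.+1 s ^+ 2) = mean (fun s => L s ^+ 2) + b ^+ 2.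
  by rewrite !mean_lin2 // ?sum_ltS // ltnW.
have -> : mean (fun s => lin u k.+1 s ^+ 2) = mean (fun s => M s ^+ 2) + c ^+ 2.
  by rewrite !mean_lin2 // ?sum_ltS // ltnW.
have -> : mean (fun s => lin l k.+1 s * lin u k.+1 s) =
    mean (fun s => L s * M s) + b * c.
  rewrite -(mean_const (b * c)) -meanD.
  apply: (@mean_split k _ _ (fun s => c * L s + b * M s)) => s;
    first by rewrite Lk Mk.
  by rewrite !linS -/(L s) -/(M s) -/b -/c;
     have := sgn_sqr s k; set e := sgn s k => e2; ring: e2.
have -> : mean (fun s => lin l k.+1 s ^+ 2 * lin u k.+1 s ^+ 2) =
    mean (fun s => L s ^+ 2 * M s ^+ 2)
    + (4 * b * c) * mean (fun s => L s * M s)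
    + c ^+ 2 * mean (fun s => L s ^+ 2) + b ^+ 2 * mean (fun s => M s ^+ 2)
    + b ^+ 2 * c ^+ 2.
  rewrite -[b ^+ 2 * c ^+ 2]mean_const -!meanZ -!meanD.
  apply: (@mean_split k _ _
    (fun s => 2 * (L s * M s + b * c) * (c * L s + b * M s))) => s.
    by rewrite Lk Mk.
  by rewrite !linS -/(L s) -/(M s) -/b -/c;
     have := sgn_sqr s k; set e := sgn s k => e2; ring: e2.
by move: IH (sqr_ge0 (b * c)); lra.
Qed.

(** In the induction step Y + e M and L + e b replace Y and L, and the left side
gains the cross term 4 b E[Y L M].  As Y has mean zero, L M may be centred in it,
with t = E[L M]; then
    4 b E[Y (L M - t)] <= 4 b^2 E Y^2 + E (L M - t)^2
and the bound on E L^2 M^2 controls the last term.  Centring matters: with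
2 E L^2 M^2 - t^2 and t^2 <= E L^2 E M^2 the total is at most 5 E L^2 E M^2, while
for 2 E L^2 M^2 alone the same bounds give only 6 E L^2 E M^2. *)
Lemma mean_quad_lin a l m : (m <= n)%N ->
  mean (fun s => quad a m s ^+ 2 * lin l m s ^+ 2) <=
  5 * mean (fun s => quad a m s ^+ 2) * mean (fun s => lin l m s ^+ 2).
Proof.
move: m; apply: segment_ind => [|k IH].
  rewrite (@eq_mean _ _ _ (fun=> 0)) => [|s];
    last by rewrite lin0 quad0 expr0n mulr0.
  rewrite mean0; apply: mulr_ge0; last exact: mean_sqr_ge0.
  by apply: mulr_ge0; [exact: ler0n | exact: mean_sqr_ge0].
have kn := ltnW (ltn_ord k).
have wick := mean_lin_mul l (a^~ k) kn.
have cs := mean_CauchySchwarz (lin l k) (lin (a^~ k) k).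
have Y0 := mean_quad a kn.
set L := lin l k in IH wick cs *; set M := lin (a^~ k) k in wick cs *.
set Y := quad a k in IH Y0 *; set b := l k.
have Lk : flip_invariant k L by exact: flip_invariant_lin.
have Mk : flip_invariant k M by exact: flip_invariant_lin.
have Yk : flip_invariant k Y by exact: flip_invariant_quad.
have -> : mean (fun s => lin l k.+1 s ^+ 2) = mean (fun s => L s ^+ 2) + b ^+ 2.
  by rewrite !mean_lin2 // sum_ltS.
have -> : mean (fun s => quad a k.+1 s ^+ 2) =
    mean (fun s => Y s ^+ 2) + mean (fun s => M s ^+ 2).
  by rewrite !mean_quad2 // sum_ltS.
have -> : mean (fun s => quad a k.+1 s ^+ 2 * lin l k.+1 s ^+ 2) =
    mean (fun s => Y s ^+ 2 * L s ^+ 2) + mean (fun s => L s ^+ 2 * M s ^+ 2)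
    + b ^+ 2 * mean (fun s => M s ^+ 2) + b ^+ 2 * mean (fun s => Y s ^+ 2)
    + (4 * b) * mean (fun s => Y s * (L s * M s)).
  rewrite -!meanZ -!meanD.
  apply: (@mean_split k _ _
    (fun s => 2 * (Y s * L s + b * M s) * (M s * L s + b * Y s))) => s.
    by rewrite Lk Mk Yk.
  rewrite quadS linS -/(L s) -/(M s) -/(Y s) -/b.
  by have := sgn_sqr s k; set e := sgn s k => e2; ring: e2.
move: wick cs; set t := mean (fun s => L s * M s) => wick cs.
have : 0 <= mean (fun s => (2 * b * Y s - (L s * M s - t)) ^+ 2).
  by apply: mean_ge0 => s; exact: sqr_ge0.
rewrite (@eq_mean _ _ _ (fun s => (4 * b ^+ 2) * Y s ^+ 2
   + (- (4 * b)) * (Y s * (L s * M s)) + (4 * b * t) * Y s + L s ^+ 2 * M s ^+ 2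
   + (- (2 * t)) * (L s * M s) + t ^+ 2)); last first.
  by move=> s; ring.
rewrite !meanD (mean_const (t ^+ 2)) !meanZ Y0 -/t.
have m0 := mulr_ge0 (sqr_ge0 b) (mean_sqr_ge0 M).
move: IH wick cs m0; lra.
Qed.

(** With p = E Y^2 and q = E L^2 the induction step reads
15 p^2 + 30 p q + 3 q^2 <= 15 (p + q)^2. *)
Lemma mean_quad4 a m : (m <= n)%N ->
  mean (fun s => quad a m s ^+ 4) <= 15 * mean (fun s => quad a m s ^+ 2) ^+ 2.
Proof.
move: m; apply: segment_ind => [|k IH].
  rewrite (@eq_mean _ _ _ (fun=> 0)) => [|s];
    last by rewrite quad0 expr0n.
  rewrite mean0; apply: mulr_ge0; [exact: ler0n | exact: sqr_ge0].
have kn := ltnW (ltn_ord k).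
have YL := mean_quad_lin a (a^~ k) kn.
have L4 := mean_lin_mul (a^~ k) (a^~ k) kn.
set L := lin (a^~ k) k in YL L4 *; set Y := quad a k in IH YL *.
have Lk : flip_invariant k L by exact: flip_invariant_lin.
have Yk : flip_invariant k Y by exact: flip_invariant_quad.
have -> : mean (fun s => quad a k.+1 s ^+ 2) =
    mean (fun s => Y s ^+ 2) + mean (fun s => L s ^+ 2).
  by rewrite !mean_quad2 // sum_ltS.
have -> : mean (fun s => quad a k.+1 s ^+ 4) =
    mean (fun s => Y s ^+ 4) + 6 * mean (fun s => Y s ^+ 2 * L s ^+ 2)
    + mean (fun s => L s ^+ 2 * L s ^+ 2).
  rewrite -!meanZ -!meanD.
  apply: (@mean_split k _ _ (fun s => 4 * Y s * L s * (Y s ^+ 2 + L s ^+ 2))) => s.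
    by rewrite Lk Yk.
  rewrite quadS -/(L s) -/(Y s).
  by have := sgn_sqr s k; set e := sgn s k => e2; ring: e2.
move: L4; rewrite (@eq_mean _ _ (fun s => L s * L s) (fun s => L s ^+ 2)) //.
have := sqr_ge0 (mean (fun s => L s ^+ 2)); move: IH YL; lra.
Qed.

End Cube.

(** * Fourth moments and the probability of being positive *)

Lemma sqrt3_bound (R : realType) : 3 / 100 < (2 * Num.sqrt (3 : R) - 3) / 15 < 1.
Proof.
have r3 : Num.sqrt 3 ^+ 2 = 3 :> R by rewrite sqr_sqrtr ?ler0n.
have r0 : 0 <= Num.sqrt 3 :> R by exact: sqrtr_ge0.
by apply/andP; split; nra.
Qed.

Section Positive.
Context (R : realType) (T : finType).

(** The normalizing constant is the inverse of the maximum of the quartic on the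
positive half-line, which is attained at (1 + sqrt 3) / 2. *)
Lemma quartic_le_indicator (y : R) :
  4 / 9 * (2 * Num.sqrt 3 - 3) * (2 * y + 3 * y ^+ 2 - y ^+ 4) <= (0 < y)%R%:R.
Proof.
have r3 : Num.sqrt 3 ^+ 2 = 3 :> R by rewrite sqr_sqrtr ?ler0n.
have r0 : 0 <= Num.sqrt 3 :> R by exact: sqrtr_ge0.
set r := Num.sqrt 3 in r3 r0 *.
have r1 : 17 / 10 <= r by nra.
set C := 4 / 9 * (2 * r - 3); have C0 : 0 <= C by rewrite /C; lra.
case: ltP => y0 /=.
  rewrite -subr_ge0.
  (* The maximizer is a double root of the difference. *)
  have -> : 1 - C * (2 * y + 3 * y ^+ 2 - y ^+ 4) =
      C * (y - (1 + r) / 2) ^+ 2 * (y ^+ 2 + (1 + r) * y + 3 / 2 * r).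
    by rewrite /C; field: r3.
  by apply: mulr_ge0; [apply: mulr_ge0; rewrite ?sqr_ge0 | nra].
have -> : 2 * y + 3 * y ^+ 2 - y ^+ 4 = - ((y + 1) ^+ 2 * (y * (y - 2))) by ring.
rewrite mulrN oppr_le0 mulr_ge0 // mulr_ge0 ?sqr_ge0 // mulr_le0 //; lra.
Qed.

(** The scale v maximizes 3 E X^2 / v^2 - kappa (E X^2)^2 / v^4, with value
9 / (4 kappa). *)
Lemma fourth_moment_mean_gt0 (X : T -> R) (kappa : R) : 0 < kappa ->
  mean X = 0 -> 0 < mean (fun s => X s ^+ 2) ->
  mean (fun s => X s ^+ 4) <= kappa * mean (fun s => X s ^+ 2) ^+ 2 ->
  (2 * Num.sqrt 3 - 3) / kappa <= mean (fun s => (0 < X s)%R%:R : R).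
Proof.
move=> kappa0 X0; set V := mean (fun s => X s ^+ 2) => V0 X4.
have w0 : 0 < 2 * kappa * V / 3.
  by apply: divr_gt0; [apply: mulr_gt0; [apply: mulr_gt0|] |].
set v := Num.sqrt (2 * kappa * V / 3).
have v2 : v ^+ 2 = 2 * kappa * V / 3 by rewrite sqr_sqrtr // ltW.
have v0 : 0 < v by rewrite sqrtr_gt0.
set C : R := 4 / 9 * (2 * Num.sqrt 3 - 3).
have C0 : 0 <= C.
  have r3 : Num.sqrt 3 ^+ 2 = 3 :> R by rewrite sqr_sqrtr ?ler0n.
  by have := sqrtr_ge0 (3 : R); rewrite /C; nra.
apply: (@le_trans _ _ (mean (fun s =>
    C * (2 * (X s / v) + 3 * (X s / v) ^+ 2 - (X s / v) ^+ 4)))).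
  rewrite (@eq_mean _ _ _ (fun s => (C * 2 / v) * X s
     + (C * 3 / v ^+ 2) * X s ^+ 2
     + (- (C / v ^+ 4)) * X s ^+ 4)); last by move=> s; field; rewrite gt_eqF.
  rewrite !meanD !meanZ X0 mulr0 add0r -/V.
  have -> : (2 * Num.sqrt 3 - 3) / kappa =
      C * (3 * V / v ^+ 2 - (kappa * V ^+ 2) / (v ^+ 2) ^+ 2).
    by rewrite v2 /C; field; rewrite ?gt_eqF.
  have -> : C * 3 / v ^+ 2 * V + - (C / v ^+ 4) * mean (fun s => X s ^+ 4) =
     C * (3 * V / v ^+ 2 - mean (fun s => X s ^+ 4) / (v ^+ 2) ^+ 2).
    by field; rewrite gt_eqF.
  by rewrite ler_wpM2l // lerD2l lerN2 ler_wpM2r // invr_ge0 !exprn_ge0 ?ltW.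
apply: le_mean => s; have := quartic_le_indicator (X s / v).
by rewrite pmulr_lgt0 ?invr_gt0.
Qed.
End Positive.

(** * From the cube of signs to a Rademacher sequence *)

Section Transfer.
Context (d : measure_display) (T : measurableType d) (R : realType).
Context (P : probability T R) (r : nat -> {RV P >-> R}).
Context (hr : rademacher_sequence r) (n : nat).
Local Notation cube := {ffun 'I_n -> bool}.

(** Indices run over naturals because independence is a statement about
subfamilies of the whole sequence; the value [false] for indices outside [0, n)
is never reached. *)
Definition sign_pattern (s : cube) : set T :=
  \bigcap_(i in [set` iota 0 n])
    (r i @^-1` [set (-1) ^+ oapp s false (insub i)]).

Lemma sign_patternE (s : cube) w :
  sign_pattern s w <-> forall i : 'I_n, r i w = sgn R s i.
Proof.
split=> [sw i|sw i /=].
  by have := sw i; rewrite /= mem_iota /= add0n ltn_ord valK => /(_ isT).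
by rewrite mem_iota add0n /= => ni; rewrite insubT; exact: sw (Ordinal ni).
Qed.

Lemma measurable_sign_pattern s : measurable (sign_pattern s).
Proof.
apply: bigcap_measurableType => i _.
by rewrite -[_ @^-1` _]setTI; exact: measurable_funP.
Qed.

Lemma probability_sign_pattern s : P (sign_pattern s) = (#|{: cube}|%:R^-1)%:E.
Proof.
have [ind r1 rN1] := hr; rewrite /sign_pattern.
rewrite (ind _ (fun i => [set (-1) ^+ oapp s false (insub i)])) ?iota_uniq //.
rewrite (eq_bigr (fun=> (2^-1)%:E)) => [|i _]; last first.
  by case: (oapp _ _ _); [exact: rN1 | exact: r1].
rewrite prodEFin card_cube natrX -exprVn.
by rewrite big_const_seq count_predT size_iota iter_mulr_1.
Qed.

Lemma probability_ge_mean (Q : pred cube) (C : set T) : measurable C ->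
  (forall s, Q s -> sign_pattern s `<=` C) ->
  ((mean (fun s => (Q s)%:R))%:E <= P C)%E.
Proof.
move=> mC QC.
apply: (@le_trans _ _ (P (\bigcup_(s in [set` Q]) sign_pattern s))); last first.
  apply: le_measure; rewrite ?inE //.
    by apply: fin_bigcup_measurable => // s _; exact: measurable_sign_pattern.
  by move=> w [s Qs]; exact: QC.
rewrite measure_fin_bigcup //; last first.
- by move=> s _; exact: measurable_sign_pattern.
- move=> s s' _ _ [w [/sign_patternE sw /sign_patternE s'w]].
  apply/ffunP => i; have := sw i; rewrite s'w => /(@signr_inj R) //.
rewrite -(@bigfs _ _ _ _ (enum cube)) ?enum_uniq => [||s]; rewrite ?mem_enum //.
rewrite (eq_bigr _ (fun s _ => probability_sign_pattern s)) sumEFin lee_fin.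
rewrite /mean mulr_suml big_enum_cond /= [leRHS]big_mkcond /=.
by apply: ler_sum => s _; case: ifP; rewrite ?mul1r ?mul0r.
Qed.

(** The chaos groups its terms by the smaller index, [quad] by the larger one. *)
Lemma chaos_sign_pattern a (s : cube) w : sign_pattern s w ->
  rademacher_chaos2 r a w = quad a n s.
Proof.
move=> /sign_patternE sw; rewrite /rademacher_chaos2 /quad /lin.
rewrite (exchange_big_dep xpredT) //= [RHS]big_mkcond /=.
apply: eq_bigr => j _; rewrite ltn_ord mulr_sumr; apply: eq_bigr => i _.
by rewrite !sw; ring.
Qed.

Lemma measurable_chaos a :
  measurable_fun [set: T] (rademacher_chaos2 (n := n) r a).
Proof.
apply: measurable_sum => i; under eq_fun do rewrite -big_filter.
apply: measurable_sum => j.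
by apply: measurable_funM => //; exact: measurable_funM.
Qed.

End Transfer.

Theorem proposition3p2 (d : measure_display) (T : measurableType d)
    (R : realType) (P : probability T R) (r : nat -> {RV P >-> R})
    (hr : rademacher_sequence r) (n : nat) (a : 'I_n -> 'I_n -> R) :
  ((((2 * Num.sqrt 3 - 3) / 15)%:E <=
      P [set w | (0 <= rademacher_chaos2 r a w)%R])%E /\
    (3 / 100 < (2 * Num.sqrt 3 - 3) / 15 :> R)) /\
  (~ (forall i j : 'I_n, (i < j)%N -> a i j = 0) ->
    (((2 * Num.sqrt 3 - 3) / 15)%:E <=
      P [set w | (0 < rademacher_chaos2 r a w)%R])%E /\
    (3 / 100 < (2 * Num.sqrt 3 - 3) / 15 :> R)).
Proof.
have /andP[c_gt c_lt] := sqrt3_bound R.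
have mX := measurable_chaos r a.
have mgt : measurable [set w | (0 < rademacher_chaos2 r a w)%R].
  rewrite -[X in measurable X]setTI.
  have := mX measurableT _ (measurable_itv `]0, +oo[).
  by congr measurable; apply/seteqP; split=> w /=; rewrite in_itv /= andbT.
have mge : measurable [set w | (0 <= rademacher_chaos2 r a w)%R].
  rewrite -[X in measurable X]setTI.
  have := mX measurableT _ (measurable_itv `[0, +oo[).
  by congr measurable; apply/seteqP; split=> w /=; rewrite in_itv /= andbT.
have positive : ~ (forall i j : 'I_n, (i < j)%N -> a i j = 0) ->
    (((2 * Num.sqrt 3 - 3) / 15)%:E <=
      P [set w | (0 < rademacher_chaos2 r a w)%R])%E.
  move=> a0.
  have V0 : 0 < mean (fun s => quad a n s ^+ 2).
    (* The second moment is the sum of the squares of the coefficients. *)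
    rewrite lt_def mean_sqr_ge0 andbT; apply: contra_not_neq a0.
    rewrite mean_quad2 // => /eqP; rewrite psumr_eq0 => [/allP h i j ij|j _];
      last exact: mean_sqr_ge0.
    have /implyP/(_ (ltn_ord j)) := h j (mem_index_enum j).
    rewrite mean_lin2 1?ltnW // psumr_eq0 => [/allP h2|? _];
      last exact: sqr_ge0.
    by have /implyP/(_ ij) := h2 i (mem_index_enum i); rewrite sqrf_eq0 => /eqP.
  apply: (le_trans _
    (probability_ge_mean hr (Q := fun s => 0 < quad a n s) mgt _)).
    rewrite lee_fin; apply: fourth_moment_mean_gt0 => //; first exact: mean_quad.
    exact: mean_quad4.
  by move=> s Qs w /= /chaos_sign_pattern ->.
split; last by move=> /positive.
split => //; have [a0|] := pselect (forall i j : 'I_n, (i < j)%N -> a i j = 0).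
  rewrite (_ : [set w | _] = setT) ?probability_setT ?lee_fin ?ltW //.
  apply/seteqP; split=> // w _ /=; rewrite /rademacher_chaos2 big1 // => i _.
  by rewrite big1 // => j ij; rewrite a0 // mulr0.
move=> /positive /le_trans; apply; apply: le_measure; rewrite ?inE //.
by move=> w /=; exact: ltW.
Qed.
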